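(* There exist sets $A$ and $E$ such that $A\le_T^{O}E$ and $A\notin \mathrm{P}^{\mathrm{SAT}\oplus E}$.
   Context: $X\oplus Y=\{0x:x\in X\}\cup\{1y:y\in Y\}$. An NPTM is a nondeterministic oracle Turing machine $N$ each of whose computation paths ends in one of three outcomes $\mathbf{acc}$, $\mathbf{rej}$, $\mathbf{?}$, such that there is a polynomial $p$ with: for every oracle $D$ and every input $x$, every computation path of $N^D(x)$ has length at most $p(|x|)$. For an oracle $D$ and input $x$, let $out_{N^D}(x)$ be the set of outcomes occurring on some path of $N^D(x)$; $L(N^D)=\{x:\mathbf{acc}\in out_{N^D}(x)\}$. $N^D(x)$ is underproductive if $\{\mathbf{acc},\mathbf{rej}\}\not\subseteq out_{N^D}(x)$, and overproductive if $out_{N^D}(x)\neq\{\mathbf{?}\}$; $N^D$ is underproductive (overproductive) if $N^D(x)$ is so for every $x$. $N$ is robustly overproductive if $N^D$ is overproductive for every oracle $D$. $A\le_T^{O}B$ if there is an NPTM $N$ that is robustly overproductive, with $N^B$ underproductive, and $A=L(N^B)$. *)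

(* Defs.v *)
From HB Require Import structures.
From mathcomp Require Import all_boot all_order all_algebra.
From mathcomp Require Import boolp classical_sets.

Set Implicit Arguments.
Unset Strict Implicit.
Unset Printing Implicit Defensive.

Local Open Scope classical_set_scope.

Definition word := seq bool.

Definition oplus (X Y : set word) : set word :=
  [set false :: x | x in X] `|` [set true :: y | y in Y].

Inductive direction := MoveLeft | Stay | MoveRight.

Definition direction_code (d : direction) : option bool :=
  match d with
  | MoveLeft => Some false | Stay => None | MoveRight => Some true
  end.

Definition direction_decode (o : option bool) : direction :=
  match o with
  | Some false => MoveLeft | None => Stay | Some true => MoveRight
  end.

Lemma direction_codeK : cancel direction_code direction_decode.
Proof. by case. Qed.

HB.instance Definition _ := Finite.copy direction (can_type direction_codeK).

(* The next state, the symbol written and the head movement on each tape, and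
   possibly a bit appended to the oracle tape. *)
Definition transition (Q S : finType) (k : nat) : finType :=
  (Q * {ffun 'I_k -> S * direction} * option bool)%type.

(* [Query qyes qno] asks whether the word on the oracle tape belongs to the
   oracle; [Step f] makes any of the transitions that [f] allows for the
   symbols under the heads. *)
Inductive instruction (O : Type) (Q S : finType) (k : nat) :=
  | Halt of O
  | Query of Q & Q
  | Step of ({ffun 'I_k -> S} -> {set transition Q S k}).

Arguments Halt {O Q S k}.
Arguments Query {O Q S k}.
Arguments Step {O Q S k}.

(* A (nondeterministic) oracle machine with [extra.+1] two-way infinite
   read-write tapes, the first of which initially holds the input, and one
   write-only oracle tape; [O] is the type of its possible outcomes. *)
Record machine (O : Type) := Machine {
  state : finType;
  symbol : finType;
  extra : nat;
  blank : symbol;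
  bit : bool -> symbol;
  start : state;
  program : state -> instruction O state symbol extra.+1;
  bit_inj : injective bit;
  bit_neq_blank : forall b, bit b != blank
}.

Section Semantics.
Variables (O : Type) (M : machine O).

(* [(l, r)] is the tape whose contents are [rev l ++ r] surrounded by blanks;
   the head is on the first symbol of [r], or on a blank if [r] is empty. *)
Definition tape := (seq (symbol M) * seq (symbol M))%type.

Definition scan (t : tape) : symbol M := head (blank M) t.2.

Definition write_move (t : tape) (a : symbol M * direction) : tape :=
  let r := a.1 :: behead t.2 in
  match a.2 with
  | MoveLeft => (behead t.1, head (blank M) t.1 :: r)
  | Stay => (t.1, r)
  | MoveRight => (a.1 :: t.1, behead t.2)
  end.

Record config := Config {
  cstate : state M;
  tapes : {ffun 'I_(extra M).+1 -> tape};
  oracle_tape : word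
}.

Definition init (x : word) : config :=
  Config (start M)
    [ffun i => ([::], if i == ord0 then map (bit M) x else [::])] [::].

Definition apply_transition (c : config)
    (m : transition (state M) (symbol M) (extra M).+1) : config :=
  let: (q, acts, out) := m in
  Config q [ffun i => write_move (tapes c i) (acts i)]
    (oracle_tape c ++ (if out is Some b then [:: b] else [::])).

(* A query takes one step and erases the oracle tape. *)
Definition step (D : set word) (c c' : config) : Prop :=
  match program (cstate c) with
  | Halt _ => False
  | Query qyes qno =>
      c' = Config (if oracle_tape c \in D then qyes else qno) (tapes c) [::]
  | Step f =>
      exists2 m, m \in f [ffun i => scan (tapes c i)] & c' = apply_transition c m
  end.

Inductive run (D : set word) : nat -> config -> config -> Prop :=
  | run0 c : run D 0 c c
  | runS n c1 c2 c3 : run D n c1 c2 -> step D c2 c3 -> run D n.+1 c1 c3.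

Definition halted (c : config) (o : O) : Prop := program (cstate c) = Halt o.

Definition out (D : set word) (x : word) : set O :=
  [set o | exists n c, run D n (init x) c /\ halted c o].

(* The second conjunct excludes paths that get stuck without an outcome. *)
Definition time_bounded (p : {poly nat}) (D : set word) : Prop :=
  forall x n c, run D n (init x) c ->
    (n <= p.[size x]%R)%N /\
    ((exists c', step D c c') \/ (exists o, halted c o)).

Definition deterministic : Prop :=
  forall (q : state M) f, program q = Step f -> forall s, (#|f s| <= 1)%N.

End Semantics.

(* [true] is the accepting outcome. *)
Definition P_rel (D : set word) : set (set word) :=
  [set L | exists M : machine bool,
    [/\ deterministic M,
        exists p, time_bounded M p D &
        L = [set x | out M D x true]]].

Inductive outcome := Acc | Rej | Unknown.

Definition NPTM (N : machine outcome) : Prop :=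
  exists p, forall D, time_bounded N p D.

Definition language (N : machine outcome) (D : set word) : set word :=
  [set x | out N D x Acc].

Definition underproductive (N : machine outcome) (D : set word) : Prop :=
  forall x, ~ [set Acc; Rej] `<=` out N D x.

Definition overproductive (N : machine outcome) (D : set word) : Prop :=
  forall x, out N D x <> [set Unknown].

Definition robustly_overproductive (N : machine outcome) : Prop :=
  forall D, overproductive N D.

Definition le_TO (A B : set word) : Prop :=
  exists N : machine outcome,
    [/\ NPTM N, robustly_overproductive N, underproductive N B &
        A = language N B].

(* Variables are named by binary words. *)
Inductive formula :=
  | Var of word
  | Not of formula
  | And of formula & formula
  | Or of formula & formula.

Fixpoint eval (v : word -> bool) (f : formula) : bool :=
  match f with
  | Var n => v n
  | Not g => ~~ eval v g
  | And g h => eval v g && eval v h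
  | Or g h => eval v g || eval v h
  end.

(* A self-delimiting code: each bit is preceded by 1, and 0 marks the end. *)
Fixpoint encode_name (n : word) : word :=
  if n is b :: n' then [:: true, b & encode_name n'] else [:: false].

(* Polish notation, with a two-bit code for each constructor. *)
Fixpoint encode (f : formula) : word :=
  match f with
  | Var n => [:: false, false & encode_name n]
  | Not g => [:: false, true & encode g]
  | And g h => [:: true, false & encode g ++ encode h]
  | Or g h => [:: true, true & encode g ++ encode h]
  end.

Lemma encode_name_prefix n n' s s' :
  encode_name n ++ s = encode_name n' ++ s' -> n = n' /\ s = s'.
Proof.
elim: n n' => [|b n IHn] [|b' n'] //= [] // -> /IHn[-> ->]; by split.
Qed.

Lemma encode_prefix f f' s s' :
  encode f ++ s = encode f' ++ s' -> f = f' /\ s = s'.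
Proof.
elim: f f' s s' => [n|g IHg|g IHg h IHh|g IHg h IHh] [n'|g'|g' h'|g' h'] s s' //=.
- by case=> /encode_name_prefix[-> ->].
- by case=> /IHg[-> ->].
- by case; rewrite -!catA => /IHg[-> /IHh[-> ->]].
- by case; rewrite -!catA => /IHg[-> /IHh[-> ->]].
Qed.

Lemma encode_inj : injective encode.
Proof.
by move=> f f' eqff'; have [] := @encode_prefix f f' [::] [::]; rewrite ?eqff'.
Qed.

Definition SAT : set word :=
  [set encode f | f in [set f | exists v, eval v f]].

(* Main.v *)
Require Import Defs.
From HB Require Import structures.
From mathcomp Require Import all_boot all_order all_algebra.
From mathcomp Require Import boolp classical_sets.
From mathcomp Require Import zify.

Set Implicit Arguments.
Unset Strict Implicit.
Unset Printing Implicit Defensive.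

(* The search problem behind the separation is the parity (Tseitin) principle on
   the de Bruijn graph.  The vertices are the words of length [n], and an oracle
   selects a set of edges, the words of length [n.+1]: the edge [e] joins [e]
   without its last bit to [e] without its first bit.  Since degrees sum to an
   even number, whatever the oracle some vertex has the wrong degree parity, if
   only [1^n] is required to have odd degree.  [N] guesses a vertex, checks that
   its parity is wrong with four queries, and then accepts or rejects according to
   one more bit of the oracle, the colour of the vertex.  It is robustly
   overproductive; it is underproductive when the edges are those traversed an
   odd number of times by a walk from [1^n], since only the end of the walk is
   then wrong.  A deterministic machine making polynomially many queries cannot
   find that end: each time it sees the last [n/2] steps of the walk, an adversary
   prolongs the walk by a word that occurs in no query.  The colour of the end is
   thus free to differ from the answer of the machine, and [SAT], being
   fixed, is of no help.  The machines are enumerated and diagonalized against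
   at lengths sparse enough not to interfere. *)

(** * Runs and their outcomes *)

Section Behaviour.
Variables (O : Type) (M : machine O).
Implicit Types (D : set word) (c : config M).

Lemma run_last D n c c' :
  run D n.+1 c c' <-> exists2 c1, run D n c c1 & step D c1 c'.
Proof.
split=> [r|[c1 r st]]; last exact: runS st.
by inversion r as [|? ? c1 ? r1 st]; subst; exists c1.
Qed.

Lemma run_cons D n c c' :
  run D n.+1 c c' <-> exists2 c1, step D c c1 & run D n c1 c'.
Proof.
elim: n c' => [|n IHn] c'.
  split=> [/run_last[c1 r st]|[c1 st r]]; inversion r; subst.
    by exists c' => //; apply: run0.
  by apply: runS st; apply: run0.
split=> [/run_last[c2 /IHn[c1 st1 r] st]|[c1 st /run_last[c2 r st2]]].
  by exists c1 => //; apply: runS st.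
by apply/run_last; exists c2 => //; apply/IHn; exists c1.
Qed.

(** Relativizes [time_bounded] and [out] to any starting configuration, so that [N] can be analysed
    backwards from its halting states. *)
Definition behaves D c (t : nat) (R : O -> Prop) : Prop :=
  (forall n c', run D n c c' ->
     (n <= t)%N /\ ((exists c'', step D c' c'') \/ exists o, halted c' o)) /\
  (forall o, (exists n c', run D n c c' /\ halted c' o) <-> R o).

Lemma behaves_le D c t t' R : (t <= t')%N -> behaves D c t R -> behaves D c t' R.
Proof.
move=> le_tt' [B1 B2]; split=> // n c' /B1[le_nt ?]; split=> //.
exact: leq_trans le_tt'.
Qed.

Lemma behaves_ext D c t R R' :
  (forall o, R o <-> R' o) -> behaves D c t R -> behaves D c t R'.
Proof. by move=> eqR [B1 B2]; split=> // o; rewrite B2. Qed.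

Lemma behaves_halt D c o t : halted c o -> behaves D c t (eq o).
Proof.
move=> h; have stuck c' : ~ step D c c' by rewrite /step h.
have run_c n c' : run D n c c' -> n = 0 /\ c' = c.
  case: n => [|n] r; first by inversion r; subst.
  by have /run_cons[c1 /stuck] := r.
split=> [n c' /run_c[-> ->]|o']; first by split=> //; right; exists o.
split=> [[n [c' [/run_c[_ ->] h']]]|<-].
  by move: h h'; rewrite /halted => -> [].
by exists 0, c; split=> //; apply: run0.
Qed.

Lemma behaves_step D c t R :
    (exists c', step D c c') ->
    (forall c', step D c c' -> behaves D c' t (R c')) ->
  behaves D c t.+1 (fun o => exists2 c', step D c c' & R c' o).
Proof.
move=> live B; split=> [n c' r|o].
  case: n r => [|n] r; first by inversion r; subst; split=> //; left.
  have /run_cons[c1 st r1] := r.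
  by have [B1 _] := B _ st; have [le_nt ?] := B1 _ _ r1.
split=> [[n [c' [r h]]]|[c1 st Ro]].
  case: n r => [|n] r.
    inversion r; subst; have [c1] := live; by rewrite /step h.
  have /run_cons[c1 st r1] := r; exists c1 => //.
  by have [_ B2] := B _ st; apply/B2; exists n, c'.
have [_ B2] := B _ st; have /B2[n [c' [r h]]] := Ro.
by exists n.+1, c'; split=> //; apply/run_cons; exists c1.
Qed.

Lemma behaves_det D c c1 t R :
  (forall c', step D c c' <-> c' = c1) -> behaves D c1 t R -> behaves D c t.+1 R.
Proof.
move=> st B; apply: (@behaves_ext _ _ _ (fun o => exists2 c', step D c c' & R o)).
  by move=> o; split=> [[]//|Ro]; exists c1; rewrite ?st.
by apply: behaves_step => [|c' /st ->//]; exists c1; rewrite st.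
Qed.

End Behaviour.

(** * The nondeterministic machine *)

Inductive phase := Rewind | Prefix | Copy | Ask.

Definition phase_code (p : phase) : bool * bool :=
  match p with
  | Rewind => (false, false) | Prefix => (false, true)
  | Copy => (true, false) | Ask => (true, true)
  end.

Definition phase_decode (b : bool * bool) : phase :=
  match b with
  | (false, false) => Rewind | (false, true) => Prefix
  | (true, false) => Copy | (true, true) => Ask
  end.

Lemma phase_codeK : cancel phase_code phase_decode.
Proof. by case. Qed.

HB.instance Definition _ := Finite.copy phase (can_type phase_codeK).

(* The five queries about a vertex [w]: [Some (false, b)] is the edge [b :: w],
   [Some (true, b)] the edge [rcons w b], and [None] the colour of [w]. *)
Definition item : finType := option (bool * bool).

Definition query_word (j : item) (w : word) : word :=
  match j with
  | Some (false, b) => [:: false, b & w]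
  | Some (true, b) => false :: rcons w b
  | None => true :: w
  end.

Inductive nstate :=
  | Guess of bool
  | Pass of bool & item & phase
  | Done of outcome.

Definition nstate_code (q : nstate) : bool + bool * item * phase + option bool :=
  match q with
  | Guess s => inl (inl s)
  | Pass s j p => inl (inr (s, j, p))
  | Done Acc => inr (Some true)
  | Done Rej => inr (Some false)
  | Done Unknown => inr None
  end.

Definition nstate_decode (q : bool + bool * item * phase + option bool) : nstate :=
  match q with
  | inl (inl s) => Guess s
  | inl (inr (s, j, p)) => Pass s j p
  | inr (Some true) => Done Acc
  | inr (Some false) => Done Rej
  | inr None => Done Unknown
  end.

Lemma nstate_codeK : cancel nstate_code nstate_decode.
Proof. by do 2?case. Qed.

HB.instance Definition _ := Finite.copy nstate (can_type nstate_codeK).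

Definition nmove (q : nstate) (a : option bool) (d : direction)
    (o : option bool) : transition nstate (option bool) 1 :=
  (q, [ffun=> (a, d)], o).

Definition after (s : bool) (j : item) (ans : bool) : nstate :=
  match j with
  | Some (false, false) => Pass (s (+) ans) (Some (false, true)) Rewind
  | Some (false, true) => Pass (s (+) ans) (Some (true, false)) Rewind
  | Some (true, false) => Pass (s (+) ans) (Some (true, true)) Rewind
  | Some (true, true) =>
      if s (+) ans then Pass true None Rewind else Done Unknown
  | None => Done (if ans then Acc else Rej)
  end.

(* The guessed vertex overwrites the input.  The boolean in the state is the
   conjunction of the guessed bits, then its sum with the answers so far. *)
Definition nprogram (q : nstate) : instruction outcome nstate (option bool) 1 :=
  match q with
  | Guess s => Step (fun v =>
      if v ord0 is Some _ then
        [set nmove (Guess (s && true)) (Some true) MoveRight None;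
             nmove (Guess (s && false)) (Some false) MoveRight None]
      else [set nmove (Pass s (Some (false, false)) Rewind) None MoveLeft None])
  | Pass s j Rewind => Step (fun v =>
      if v ord0 is Some b then
        [set nmove (Pass s j Rewind) (Some b) MoveLeft None]
      else [set nmove (Pass s j Prefix) None MoveRight (Some (j == None))])
  | Pass s j Prefix => Step (fun v =>
      [set nmove (Pass s j Copy) (v ord0) Stay
             (if j is Some (false, b) then Some b else None)])
  | Pass s j Copy => Step (fun v =>
      if v ord0 is Some b then
        [set nmove (Pass s j Copy) (Some b) MoveRight (Some b)]
      else [set nmove (Pass s j Ask) None MoveLeft
                  (if j is Some (true, b) then Some b else None)])
  | Pass s j Ask => Query (after s j true) (after s j false)
  | Done o => Halt o
  end.

Definition N : machine outcome :=
  @Machine outcome nstate (option bool) 0 None Some (Guess true) nprogram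
    (fun _ _ eq_b => Some_inj eq_b) (fun=> isT).

Definition cfg (q : nstate) (t : tape N) (o : word) : config N :=
  @Config outcome N q [ffun=> t] o.

Definition emit (b : option bool) : word := if b is Some b then [:: b] else [::].

Lemma apply_nmove q t o q' a d b :
  @apply_transition outcome N (cfg q t o) (nmove q' a d b) =
  cfg q' (write_move t (a, d)) (o ++ emit b).
Proof. by congr Config; apply/ffunP=> i; rewrite !ffunE. Qed.

Lemma scan_cfg q t o : [ffun i => scan (tapes (cfg q t o) i)] = [ffun=> scan t].
Proof. by apply/ffunP=> i; rewrite !ffunE. Qed.

Lemma step_nmove D q (t : tape N) o f q' a d b :
    nprogram q = Step f -> f [ffun=> scan t : option bool] = [set nmove q' a d b] ->
  forall c', step D (cfg q t o) c' <->
             c' = cfg q' (write_move t (a, d)) (o ++ emit b).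
Proof.
move=> eq_q eq_f c'; rewrite -(apply_nmove q) /step scan_cfg [program _]eq_q.
split=> [[m f_m ->]|->].
  have: m \in f [ffun=> scan t : option bool] by exact: f_m.
  by rewrite eq_f => /set1P->.
exists (nmove q' a d b) => //.
suff: nmove q' a d b \in f [ffun=> scan t : option bool] by [].
by rewrite eq_f set11.
Qed.

Lemma copy_pass D s j (w : word) l z o t R :
    head None z = None ->
    behaves D (cfg (Pass s j Ask)
      (@write_move _ N (rev (map Some w) ++ l, z) (None, MoveLeft))
      (o ++ w ++ emit (if j is Some (true, b) then Some b else None))) t R ->
  behaves D (cfg (Pass s j Copy) (l, map Some w ++ z) o) (t + size w).+1 R.
Proof.
move=> z0; elim: w l o => [|b w IHw] l o B.
  apply: behaves_det; last by rewrite addn0; exact: B.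
  by apply: step_nmove => //; rewrite /= ffunE /scan /= z0.
rewrite addnS; apply: behaves_det.
  by apply: step_nmove => //; rewrite /= ffunE.
  by apply: IHw; rewrite -cat_rcons -rev_cons -catA.
Qed.

Lemma rewind_pass D s j (u : word) l z o t R :
    head None l = None ->
    behaves D (cfg (Pass s j Prefix)
      (None :: behead l, map Some (rev u) ++ z) (rcons o (j == None))) t R ->
  behaves D (cfg (Pass s j Rewind)
    (behead (map Some u ++ l), head None (map Some u ++ l) :: z) o)
    (t + size u).+1 R.
Proof.
move=> l0; elim: u z => [|b u IHu] z B.
  apply: behaves_det; last by rewrite addn0; exact: B.
  rewrite -cats1 => c'.
  apply: (@step_nmove D _ _ _ _ _ None MoveRight (Some (j == None))) => //.
  by rewrite /= ffunE /scan /= l0.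
rewrite addnS; apply: behaves_det.
  by apply: step_nmove => //; rewrite /= ffunE.
rewrite cats0; apply: IHu.
by move: B; rewrite rev_cons map_rcons cat_rcons.
Qed.

(** The head is on the last letter of [w], or on the blank to its left if [w] is empty. Earlier
    passes leave explicit blanks, hence [l] and [z] instead of empty lists. *)
Definition parked (w : word) (t : tape N) : Prop :=
  exists l z, [/\ t = @write_move _ N (rev (map Some w) ++ l, z) (None, MoveLeft),
                  head None l = None & head None z = None].

Lemma pass_behaves D s j w t T R :
    parked w t ->
    (forall t', parked w t' ->
       behaves D (cfg (after s j (query_word j w \in D)) t' [::]) T R) ->
  behaves D (cfg (Pass s j Rewind) t [::]) (T + (size w).*2 + 4) R.
Proof.
move=> [l [z [-> l0 z0]]] B.
(* Rewinding and copying take [size w + 1] steps each, [Prefix] and [Ask] one step each. *)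
have -> : T + (size w).*2 + 4 = (((T.+1 + size w).+1).+1 + size (rev w)).+1.
  by rewrite size_rev; lia.
rewrite /write_move /= -map_rev.
apply: rewind_pass => //; rewrite revK.
apply: behaves_det; first exact: step_nmove.
rewrite /write_move /scan /= ffunE.
have -> : head None (map Some w ++ None :: behead z) ::
  behead (map Some w ++ None :: behead z) = map Some w ++ None :: behead z.
  by case: w {B}.
apply: copy_pass => //.
apply: behaves_det (B _ _); last by exists (None :: behead l), (None :: behead z).
move=> c'; rewrite (_ : _ ++ w ++ _ = query_word j w).
  by rewrite /step /=; case: ifP.
by case: j {B} => [[[] b]|] //=; rewrite ?cats0 ?cats1.
Qed.

Definition unbalanced (D : set word) (w : word) : bool :=
  all id w (+) ([:: false, false & w] \in D) (+) ([:: false, true & w] \in D)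
    (+) (false :: rcons w false \in D) (+) (false :: rcons w true \in D).

Definition verdict (D : set word) (w : word) : outcome :=
  if unbalanced D w then if true :: w \in D then Acc else Rej else Unknown.

Lemma verdict_behaves D w t : parked w t ->
  behaves D (cfg (Pass (all id w) (Some (false, false)) Rewind) t [::])
    (10 * size w + 20) (eq (verdict D w)).
Proof.
move=> pt; have -> : 10 * size w + 20 = 0 + (size w).*2 + 4 + (size w).*2 + 4
  + (size w).*2 + 4 + (size w).*2 + 4 + (size w).*2 + 4 by lia.
do 4!(apply: pass_behaves => // {pt}t pt /=).
rewrite -/(unbalanced D w) /verdict.
case: ifP => _; last exact: behaves_halt.
by apply: pass_behaves => // {pt}t _ /=; apply: behaves_halt.
Qed.

Lemma guess_behaves D g x :
  behaves D (cfg (Guess (all id g)) (rev (map Some g), map Some x) [::])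
    (10 * (size g + size x) + 20 + (size x).+1)
    (fun o => exists2 w, size w = size x & verdict D (g ++ w) = o).
Proof.
elim: x g => [|a x IHx] g.
  apply: (@behaves_ext _ _ _ _ _ (eq (verdict D g))).
    move=> o; split=> [<-|[w /size0nil ->]]; last by rewrite cats0.
    by exists [::]; rewrite ?cats0.
  rewrite /= addn0 addn1; apply: behaves_det.
    by apply: step_nmove => //; rewrite /= ffunE.
  apply: verdict_behaves; exists [::], [::]; by rewrite cats0.
pose c b : config N := cfg (Guess (all id (rcons g b)))
  (rev (map Some (rcons g b)), map Some x) [::].
have stE c' : step D (cfg (Guess (all id g))
    (rev (map Some g), map Some (a :: x)) [::]) c' <-> exists b, c' = c b.
  have cE b : c b = apply_transition (cfg (Guess (all id g))
      (rev (map Some g), map Some (a :: x)) [::])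
      (nmove (Guess (all id g && b)) (Some b) MoveRight None).
    by rewrite apply_nmove /c all_rcons map_rcons rev_rcons andbC.
  rewrite /step scan_cfg /= ffunE /=; split=> [[m /set2P[] -> ->]|[b ->]].
  - by exists true; rewrite cE.
  - by exists false; rewrite cE.
  - rewrite cE; exists (nmove (Guess (all id g && b)) (Some b) MoveRight None) => //.
    by case: b; rewrite ?set21 ?set22.
(* [behaves_step] indexes the outcomes by the successor configuration, so the guessed bit has to be
   recovered from its tape. *)
rewrite addnS; apply: (@behaves_ext _ _ _ _ _ (fun o => exists2 c',
  step D (cfg (Guess (all id g)) (rev (map Some g), map Some (a :: x)) [::]) c'
  & exists b, c' = c b /\
    exists2 w, size w = size x & verdict D (rcons g b ++ w) = o)).
  move=> o; split=> [[_ _ [b [_ [w sz <-]]]]|[[|b w] //= [sz] <-]].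
    by exists (b :: w); rewrite /= ?sz ?cat_rcons.
  exists (c b); first by apply/stE; exists b.
  by exists b; split=> //; exists w; rewrite ?cat_rcons.
apply: behaves_step => [|c' /stE[b ->]]; first by exists (c true); apply/stE; exists true.
have := IHx (rcons g b); rewrite size_rcons => B.
apply: (@behaves_le _ _ _ _ (10 * ((size g).+1 + size x) + 20 + (size x).+1)).
  by rewrite /=; lia.
apply: behaves_ext B => o; split=> [[w ? <-]|[b' [eq_c [w ? <-]]]].
  by exists b; split=> //; exists w.
exists w => //; have /(congr1 rev) :
    rev (map Some (rcons g b)) = rev (map Some (rcons g b')).
  by move: eq_c => /(congr1 (fun c => (tapes c ord0).1)); rewrite /= !ffunE.
by rewrite !revK !map_rcons => /rcons_inj[->].
Qed.

(** * Parity and walks in the de Bruijn graph *)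

Fixpoint parity (n : nat) (F : word -> bool) : bool :=
  if n is n'.+1 then
    parity n' (fun w => F (false :: w)) (+) parity n' (fun w => F (true :: w))
  else F [::].

(** Splitting on the first or on the last bit groups the edges by target or by source: this is the
    double counting of the degree sum. *)
Lemma parity_rcons n F :
  parity n.+1 F =
  parity n (fun w => F (rcons w false)) (+) parity n (fun w => F (rcons w true)).
Proof.
elim: n F => [|n IHn] F //.
have parityS m G : parity m.+1 G =
  parity m (fun w => G (false :: w)) (+) parity m (fun w => G (true :: w)) by [].
rewrite [LHS]parityS (IHn (fun w => F (false :: w))) (IHn (fun w => F (true :: w))).
by rewrite !parityS addbACA.
Qed.

Lemma parity_add n F G :
  parity n (fun w => F w (+) G w) = parity n F (+) parity n G.
Proof. by elim: n F G => [|n IHn] F G //=; rewrite !IHn addbACA. Qed.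

Lemma parity_false n : parity n (fun=> false) = false.
Proof. by elim: n => //= n ->. Qed.

Lemma parity_all n : parity n (all id) = true.
Proof. by elim: n => //= n IHn; rewrite parity_false. Qed.

Lemma parity_odd n F : parity n F -> exists2 w, size w = n & F w.
Proof.
elim: n F => [|n IHn] F /=; first by exists [::].
case E: (parity n (fun w => F (true :: w))).
  by move=> _; have [w sz Fw] := IHn _ E; exists (true :: w); rewrite /= ?sz.
by rewrite addbF => /IHn[w sz Fw]; exists (false :: w); rewrite /= ?sz.
Qed.

(* Summed over all the vertices, the degrees count every edge twice. *)
Lemma odd_vertex (F : word -> bool) n :
  exists2 w, size w = n &
    all id w (+) F (false :: w) (+) F (true :: w)
      (+) F (rcons w false) (+) F (rcons w true).
Proof.
apply: parity_odd; rewrite !parity_add parity_all.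
have := parity_rcons n F; rewrite /=.
by do 4!case: (parity n _).
Qed.

Fixpoint trail (v s : word) : seq word :=
  if s is b :: s' then rcons v b :: trail (behead (rcons v b)) s' else [::].

(** The walk slides a window of length [size v] along [v ++ s]. *)
Definition trail_end (v s : word) : word := drop (size s) (v ++ s).

Lemma trail_end_cons v b s :
  trail_end v (b :: s) = trail_end (behead (rcons v b)) s.
Proof. by rewrite /trail_end -cat_rcons; case: v. Qed.

Lemma size_trail_end v s : size (trail_end v s) = size v.
Proof. by rewrite size_drop size_cat addnK. Qed.

Lemma trail_cat v s t : trail v (s ++ t) = trail v s ++ trail (trail_end v s) t.
Proof.
elim: s v => [|b s IHs] v /=; first by rewrite /trail_end cats0 drop0.
by rewrite trail_end_cons IHs.
Qed.

Lemma trail_end_cat v s t : trail_end v (s ++ t) = trail_end (trail_end v s) t.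
Proof.
elim: s v => [|b s IHs] v /=; first by rewrite [trail_end v [::]]/trail_end cats0 drop0.
by rewrite !trail_end_cons IHs.
Qed.

Lemma rcons_eq_behead (w e : word) : size e = (size w).+1 ->
  (rcons w false == e) (+) (rcons w true == e) = (w == take (size w) e).
Proof.
case/lastP: e => // e b; rewrite size_rcons => -[sz].
rewrite -sz -[in take _ _]cats1 take_size_cat ?sz // !eqseq_rcons [in LHS]eq_sym.
by rewrite [e == w]eq_sym; case: (w == e); case: b.
Qed.

Lemma cons_eq_behead (w e : word) : size e = (size w).+1 ->
  (false :: w == e) (+) (true :: w == e) = (w == behead e).
Proof. by case: e => // b e _; rewrite !eqseq_cons /=; case: (w == e); case: b. Qed.

Definition traversed (v s e : word) : bool := odd (count_mem e (trail v s)).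

(** Each traversal of an edge changes the degree parity at its two ends; along the walk these
    changes telescope modulo 2. *)
Lemma trail_degree v s w : size w = size v ->
  traversed v s (false :: w) (+) traversed v s (true :: w)
    (+) traversed v s (rcons w false) (+) traversed v s (rcons w true)
  = (w == v) (+) (w == trail_end v s).
Proof.
rewrite /traversed.
elim: s v => [|b s IHs] v sz /=.
  by rewrite /trail_end cats0 drop0 addbb.
set e := rcons v b; have sz_e : size e = (size w).+1 by rewrite size_rcons sz.
rewrite trail_end_cons -/e !oddD.
have /IHs {}IHs : size w = size (behead e) by rewrite size_behead sz_e.
have := rcons_eq_behead sz_e; have := cons_eq_behead sz_e.
have -> : take (size w) e = v by rewrite sz /e -cats1 take_size_cat.
move=> h1 h2.
(* The vertex reached after one step is inserted twice: [h1] and [h2] account for the first edge,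
   [IHs] for the rest. *)
have -> : (w == v) (+) (w == trail_end (behead e) s) =
  (w == v) (+) (w == behead e) (+) ((w == behead e) (+) (w == trail_end (behead e) s)).
  by rewrite -!addbA [(w == behead e) (+) ((w == behead e) (+) _)]addbA addbb.
rewrite -IHs -h1 -h2 !(eq_sym e) !oddb.
move: (_ == e) (_ == e) (_ == e) (_ == e) => b1 b2 b3 b4.
move: (odd _) (odd _) (odd _) (odd _) => c1 c2 c3 c4.
by case: b1; case: b2; case: b3; case: b4; case: c1; case: c2; case: c3; case: c4.
Qed.

(** Each step drops one letter in front, so [size a] steps leave [c] intact; one further edge still
    contains [c], since an edge keeps all the letters of its source. *)
Lemma trail_infix (c a z t e : word) :
  size t <= (size a).+1 -> e \in trail (a ++ c ++ z) t -> infix c e.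
Proof.
elim: t a z => [|b t IHt] a z //= le_ta; rewrite inE => /orP[/eqP->|].
  by rewrite -cats1 -!catA catA; apply/infixP; exists a, (z ++ [:: b]); rewrite !catA.
case: a le_ta => [|x a] /= le_ta; first by case: t le_ta {IHt}.
rewrite !rcons_cat /=; exact: IHt.
Qed.

(** * Counting infixes *)

Definition infixes (h : nat) (e : word) : seq word :=
  [seq take h (drop i e) | i <- iota 0 (size e).+1].

Lemma mem_infixes h c e : size c = h -> infix c e -> c \in infixes h e.
Proof.
move=> <- /infixP[a [z ->]]; apply/mapP; exists (size a).
  by rewrite mem_iota add0n ltnS !size_cat /= leq_addr.
by rewrite drop_size_cat // take_size_cat.
Qed.

(** Pigeonhole: the words of [S] have at most [size S * k.+1] infixes of length [h], fewer than the
    [2 ^ h] words of that length. *)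
Lemma fresh_word h k (S : seq word) :
    all (fun e => size e <= k) S -> size S * k.+1 < 2 ^ h ->
  exists2 c, size c = h & all (fun e => ~~ infix c e) S.
Proof.
move=> szS ltS; apply: contrapT => none.
pose L := flatten [seq infixes h e | e <- S].
have szL : size L <= size S * k.+1.
  rewrite /L; elim: (S) szS => //= e S' IHS /andP[le_ek /IHS le_S].
  by rewrite size_cat size_map size_iota mulSn; apply: leq_add.
have sub : {subset map val (enum {: h.-tuple bool}) <= L}.
  move=> _ /mapP[c _ ->]; apply: contrapT => notL; apply: none.
  exists (val c); first exact: size_tuple.
  apply/allP => e Se; apply/negP => /(mem_infixes (size_tuple c)) ce.
  by apply: notL; apply/flattenP; exists (infixes h e) => //; apply: map_f.
have /uniq_leq_size/(_ sub) : uniq (map val (enum {: h.-tuple bool})).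
  by rewrite map_inj_uniq ?enum_uniq //; apply: val_inj.
rewrite size_map -cardE card_tuple card_bool leqNgt => /negP; apply.
exact: leq_ltn_trans ltS.
Qed.

(** * Oracles built from walks, one for each length *)

Definition block := (word * bool)%type.

(* The walk of block [n] starts at the vertex [1^n] and appends the bits [(f n).1];
   [(f n).2] is the colour of its end. *)
Definition oracle_mem (f : nat -> block) (u : word) : bool :=
  match u with
  | false :: ((_ :: v) as e) => traversed (nseq (size v) true) (f (size v)).1 e
  | true :: v => (v == trail_end (nseq (size v) true) (f (size v)).1) && (f (size v)).2
  | _ => false
  end.

Definition oracle (f : nat -> block) : set word := fun u => oracle_mem f u.

Lemma in_oracle f u : (u \in oracle f) = oracle_mem f u.
Proof. by apply/idP/idP => [/set_mem|/mem_set]. Qed.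

Definition front (f : nat -> block) (n : nat) : word :=
  trail_end (nseq n true) (f n).1.

Lemma oracle_edge f e n : size e = n.+1 ->
  (false :: e \in oracle f) = traversed (nseq n true) (f n).1 e.
Proof. by case: e => // b e [<-]; rewrite in_oracle. Qed.

Lemma oracle_colour f v n : size v = n ->
  (true :: v \in oracle f) = (v == front f n) && (f n).2.
Proof. by move=> <-; rewrite in_oracle. Qed.

(** A word concerns at most one block, of index below its length; hence finitely many blocks settle
    all the answers of a time-bounded run. *)
Lemma oracle_local f g u : (forall n, n <= size u -> f n = g n) ->
  (u \in oracle f) = (u \in oracle g).
Proof.
case: u => [|[] u] eq_fg; first by rewrite !in_oracle.
  by rewrite !(@oracle_colour _ _ (size u)) // /front eq_fg.
case: u eq_fg => [|b u] eq_fg; first by rewrite !in_oracle.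
by rewrite !(@oracle_edge _ _ (size u)) // eq_fg //=; lia.
Qed.

Definition upd (f : nat -> block) (n : nat) (p : block) : nat -> block :=
  fun m => if m == n then p else f m.

(** The old end, the new end and all the new edges contain [c], because [t] is not longer than [a].
    Colours are visible only at these ends, so [q] may differ from [p]. *)
Lemma oracle_extend f n s t c a p q u :
    front (upd f n (s, p)) n = a ++ c -> size t <= size a -> ~~ infix c u ->
  (u \in oracle (upd f n (s ++ t, q))) = (u \in oracle (upd f n (s, p))).
Proof.
rewrite /front /upd eqxx /= => end_s le_ta no_c.
case: u no_c => [|[] u] no_c; first by rewrite !in_oracle.
  rewrite !(@oracle_colour _ _ (size u)) // /front.
  case: ifP => // /eqP sz_u /=.
  have -> : (u == trail_end (nseq (size u) true) (s ++ t)) = false.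
    apply: contraNF no_c => /eqP->; rewrite sz_u trail_end_cat end_s.
    rewrite /trail_end -catA drop_cat; case: ltnP => [_|le_at].
      by apply/infixP; eexists (true :: _), t; rewrite /= -?catA; reflexivity.
    have -> : size t - size a = 0 by lia.
    by rewrite drop0; apply/infixP; exists [:: true], t.
  have -> // : (u == trail_end (nseq (size u) true) s) = false.
  apply: contraNF no_c => /eqP->; rewrite sz_u end_s.
  by apply/infixP; exists (true :: a), [::]; rewrite cats0.
case: u no_c => [|b u] no_c; first by rewrite !in_oracle.
rewrite !(@oracle_edge _ _ (size u)) //; case: ifP => // /eqP sz_u.
rewrite /traversed trail_cat count_cat oddD sz_u end_s.
rewrite [X in _ (+) odd X](_ : _ = 0) ?addbF //.
apply/count_memPn; apply: contra no_c => e_t.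
have := @trail_infix c a [::] t (b :: u) (leqW le_ta).
rewrite cats0 => /(_ e_t)/infixP[x [y ->]].
by apply/infixP; exists (false :: x), y.
Qed.

(** * The adversary *)

Lemma mem_oplus (X Y : set word) u :
  (u \in oplus X Y) =
  match u with
  | [::] => false
  | false :: x => x \in X
  | true :: y => y \in Y
  end.
Proof.
apply/idP/idP => [/set_mem[] [x Xx <-]|]; try exact: mem_set.
case: u => [|[] u] // /set_mem Xu; apply: mem_set; first by right; exists u.
by left; exists u.
Qed.

Section Determinism.
Variables (O : Type) (M : machine O).
Implicit Types (D : set word) (c : config M).

(** The left summand is common to both oracles, so only words tagged [true] can tell them apart;
    this neutralizes [SAT]. *)
Lemma step_agree X D D' c c' :
    (forall e, oracle_tape c = true :: e -> (e \in D) = (e \in D')) ->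
  step (oplus X D) c c' -> step (oplus X D') c c'.
Proof.
move=> eqD; rewrite /step; case: (program (cstate c)) => // q1 q2 ->.
rewrite !mem_oplus; case: (oracle_tape c) eqD => [|[] e] // eqD.
by rewrite (eqD e).
Qed.

Lemma size_oracle_tape D n c c' :
  run D n c c' -> size (oracle_tape c') <= size (oracle_tape c) + n.
Proof.
elim: n c' => [|n IHn] c' r; first by inversion r; subst; rewrite addn0.
inversion r as [|? ? c2 ? r1 st]; subst; have {r1}/IHn le2 := r1.
apply: leq_trans (_ : (size (oracle_tape c2)).+1 <= _); last by rewrite addnS.
move: st; rewrite /step; case: (program _) => // [q1 q2 -> //|g [[[q acts] o] _ ->]].
by rewrite /= size_cat; case: o => [b|]; rewrite /= ?addn1 ?addn0.
Qed.

Hypothesis detM : deterministic M.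

Lemma det_step D c c1 c2 : step D c c1 -> step D c c2 -> c1 = c2.
Proof.
rewrite /step; case E: (program _) => [o|q1 q2|g] //; first by move=> -> ->.
case=> m1 gm1 -> [m2 gm2 ->].
by have /card_le1_eqP/(_ _ _ gm1 gm2)-> := detM E [ffun i => scan (tapes c i)].
Qed.

Lemma det_run D n c c1 c2 : run D n c c1 -> run D n c c2 -> c1 = c2.
Proof.
elim: n c1 c2 => [|n IHn] c1 c2 r1 r2; first by inversion r1; inversion r2; subst.
inversion r1 as [|? ? c1' ? r1' st1]; subst.
inversion r2 as [|? ? c2' ? r2' st2]; subst.
by apply: det_step st1 _; rewrite (IHn _ _ r1' r2').
Qed.

End Determinism.

Section Adversary.
Variables (M : machine bool) (f : nat -> block) (x : word) (n h K : nat).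
Hypotheses (detM : deterministic M) (le_hn : h.*2 <= n) (ltK : K * K.+1 < 2 ^ h).

Local Notation orc s p := (oracle (upd f n (s, p))).

Lemma front_upd s p : front (upd f n (s, p)) n = trail_end (nseq n true) s.
Proof. by rewrite /front /upd eqxx. Qed.

Lemma size_front g : size (front g n) = n.
Proof. by rewrite size_trail_end size_nseq. Qed.

(* As soon as the last [h] steps of the walk become visible in a query, the
   walk moves on; no edge queried so far is affected. *)
Lemma adversary k : k <= K -> exists s S c a,
  [/\ size S <= k, all (fun e => size e <= K) S,
      front (upd f n (s, false)) n = a ++ c, size c = h &
      all (fun e => ~~ infix c e) S /\
      forall D, {in S, forall e, (e \in D) = (e \in orc s false)} ->
      forall j c', j <= k ->
      run (oplus SAT D) j (init M x) c' <->
      run (oplus SAT (orc s false)) j (init M x) c'].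
Proof.
elim: k => [_|k IHk lt_kK].
  (* The empty walk ends at [1^n], split as [1^(n-h)] followed by [1^h]. *)
  exists [::], [::], (nseq h true), (nseq (n - h) true).
  rewrite size_nseq; split=> //.
    rewrite front_upd /trail_end cats0 drop0 -nseqD; congr nseq; lia.
  split=> // D _ [] // c' _; split=> r; inversion r; subst; exact: run0.
have [s [S [c [a [szS leS end_s sz_c [no_c agree]]]]]] := IHk (ltnW lt_kK).
set D0 := orc s false in agree.
have sz_ac : size a + size c = n by rewrite -size_cat -end_s size_front.
(* The word on the oracle tape after [k] steps is protected whether or not the next instruction is a
   query. *)
case: (pselect (exists c1 e,
    run (oplus SAT D0) k (init M x) c1 /\ oracle_tape c1 = true :: e)); last first.
  move=> no_query; exists s, S, c, a; split=> //; first exact: leqW.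
  split=> // D agD j c'; rewrite leq_eqVlt => /predU1P[->|]; last exact: agree.
  have tape_c1 c1 e : run (oplus SAT D0) k (init M x) c1 ->
      oracle_tape c1 = true :: e -> (e \in D) = (e \in D0).
    by move=> r1 tape; case: no_query; exists c1, e.
  split=> /run_last[c1 r1 st].
    have {}r1 : run (oplus SAT D0) k (init M x) c1 by apply/(agree D).
    by apply: (runS r1); apply: step_agree st => e /(tape_c1 _ _ r1).
  apply: runS (_ : run _ k _ c1) _; first exact/(agree D).
  by apply: step_agree st => e /(tape_c1 _ _ r1).
move=> [c1 [e [r1 tape1]]].
have sz_e : size e <= K.
  by have := size_oracle_tape r1; rewrite tape1 /= => lt_e; apply: ltnW; lia.
(* With [e] there are at most [K] words to avoid, so [ltK] leaves room for [b]. *)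
have [b sz_b fresh_b] : exists2 b, size b = h & all (fun e => ~~ infix b e) (e :: S).
  apply: (@fresh_word h K) => /=; first by rewrite sz_e.
  by apply: leq_ltn_trans ltK; apply: leq_mul => //; apply: leq_ltn_trans lt_kK.
have le_ba : size b <= size a by rewrite sz_b; lia.
(* Walking along [b] preserves the answers on [S], whose words avoid the old [c]. The answer to [e]
   may change; from now on it is that of [D1]. *)
set D1 := orc (s ++ b) false.
have D01 : {in S, forall u, (u \in D1) = (u \in D0)}.
  by move=> u /(allP no_c); apply: oracle_extend end_s _.
exists (s ++ b), (e :: S), b, (drop (size b) (a ++ c)); split=> //=.
- by rewrite sz_e.
- move: end_s; rewrite !front_upd trail_end_cat => ->; rewrite {1}/trail_end drop_cat.
  case: ltnP => [//|le_acb]; rewrite (drop_oversize le_acb) size_cat.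
  have /eqP-> : size b - (size a + size c) == 0.
    by rewrite subn_eq0 (leq_trans le_ba) ?leq_addr.
  by rewrite drop0.
split=> // D agD.
have agD0 : {in S, forall u, (u \in D) = (u \in D0)}.
  by move=> u Su; rewrite agD ?inE ?Su ?orbT // D01.
have same j c' : j <= k -> run (oplus SAT D) j (init M x) c' <->
    run (oplus SAT D1) j (init M x) c'.
  by move=> le_jk; rewrite (agree D agD0) // (agree D1 D01).
have eq_e : (e \in D) = (e \in D1) by rewrite agD ?mem_head.
(* By determinism [c1] is the only configuration after [k] steps, so [e] is the only new word to
   protect. *)
have only_c1 c2 : run (oplus SAT D) k (init M x) c2 -> c2 = c1.
  by move=> /(agree D agD0 _ _ (leqnn k)) r2; apply: det_run r2 r1.
move=> j c'; rewrite leq_eqVlt => /predU1P[->|]; last exact: same.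
split=> /run_last[c2 r2 st].
  apply: runS (_ : run _ k _ c2) _; first exact/same.
  by apply: step_agree st => e'; rewrite (only_c1 c2 r2) tape1 => -[<-].
have {}r2 : run (oplus SAT D) k (init M x) c2 by apply/same.
apply: (runS r2).
by apply: step_agree st => e'; rewrite (only_c1 c2 r2) tape1 => -[<-].
Qed.

End Adversary.

(** * Polynomials against exponentials *)

Lemma horner_le_exp (p : {poly nat}) : exists d, forall x, (p.[x]%R <= x.+2 ^ d)%N.
Proof.
elim/poly_ind: p => [|p c [d le_p]].
  by exists 0 => x; rewrite horner0.
(* The base is at least 2 even at [x = 0]: the exponent [c] absorbs the constant term, and 2 absorbs
   the factor [x] and the sum. *)
exists (d + c + 2) => x; rewrite hornerMXaddC.
change (p.[x]%R * x + c <= x.+2 ^ (d + c + 2)).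
have le_c : c <= x.+2 ^ c by apply: ltnW; apply: ltn_expl.
have lt1 : 0 < x.+2 ^ d by rewrite expn_gt0.
have lt2 : 0 < x.+2 ^ c by rewrite expn_gt0.
have := le_p x; rewrite !expnD; move: (p.[x]%R) (x.+2 ^ d) (x.+2 ^ c) le_c lt1 lt2.
move=> P A B le_c lt1 lt2 le_P.
have : P * x <= A * x.+2 by apply: leq_mul; lia.
have : A <= A * B by rewrite leq_pmulr.
have : B <= A * B by rewrite leq_pmull.
rewrite expnS expn1; nia.
Qed.

Lemma exp_dominates (p : {poly nat}) b :
  exists2 n, b <= n & p.[n]%R * p.[n]%R.+1 < 2 ^ n./2.
Proof.
have [d le_p] := horner_le_exp p.
(* Since [n.+2] is 2 to the power [u.*2.+1], [p.[n]] is at most 2 to an exponent linear in [u],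
   while [n./2] is exponential in [u]. The summand [4 * d + 4] makes the latter win; [b] ensures
   [b <= n]. *)
pose u := 4 * d + 4 + b; pose n := (2 ^ u.*2).-1.*2.
have lt_u : u.+1 <= 2 ^ u by apply: ltn_expl.
have exp_u : 2 ^ u.*2 = 2 ^ u * 2 ^ u by rewrite -addnn expnD.
have n2 : n.+2 = 2 ^ u.*2.+1 by rewrite expnS exp_u /n exp_u; nia.
exists n; first by rewrite /n exp_u; nia.
have := le_p n; rewrite n2 -expnM => le_K.
have pos : 0 < 2 ^ (u.*2.+1 * d) by rewrite expn_gt0.
apply: (@leq_ltn_trans (2 ^ (u.*2.+1 * d + (u.*2.+1 * d).+1))).
  by rewrite expnD expnS; apply: leq_mul => //; lia.
rewrite ltn_exp2l // /n doubleK exp_u; nia.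
Qed.

(** The adversary plays on [1^n] up to the time bound, then the colour of the end is set to the
    negation of the answer. By [oracle_extend] with an empty extension, no query sees that
    colour. *)
Lemma diagonal_block (M : machine bool) (p : {poly nat}) (f : nat -> block) b :
    deterministic M ->
  exists f' b', [/\ b < b', forall n, n < b -> f' n = f n &
    forall g, (forall n, n < b' -> g n = f' n) ->
      time_bounded M p (oplus SAT (oracle g)) ->
      exists n, ~ (out M (oplus SAT (oracle g)) (nseq n true) true <-> (g n).2)].
Proof.
move=> detM; have [n le_bn ltK] := exp_dominates p b; set K := p.[n]%R in ltK.
have le_hn : n./2.*2 <= n by have := odd_double_half n; lia.
have [s [S [c [a [_ leS end_s sz_c [no_c agree]]]]]] :=
  adversary f (nseq n true) detM le_hn ltK (leqnn K).
set D0 := oracle (upd f n (s, false)) in agree.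
(* The time bound is known only for the final oracle [g], so acceptance with [D0] is truncated at
   [K] steps. *)
pose acc := exists j c', [/\ j <= K, run (oplus SAT D0) j (init M (nseq n true)) c'
  & halted c' true].
(* The words of [S] have length at most [K], so freezing the blocks up to [maxn n K] fixes their
   answers and the colour of block [n]. *)
exists (upd f n (s, ~~ `[< acc >])), (maxn n K).+1; split.
- by rewrite ltnS leq_max le_bn.
- by move=> m lt_mb; rewrite /upd; case: eqP => // eq_mn; lia.
move=> g eq_g bounded; exists n.
have agree_g : {in S, forall e, (e \in oracle g) = (e \in D0)}.
  move=> e Se; have le_e := allP leS _ Se.
  rewrite (@oracle_local g (upd f n (s, ~~ `[< acc >]))).
    by rewrite -[s in LHS]cats0; apply: (oracle_extend _ end_s) => //; apply: (allP no_c).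
  by move=> m le_me; apply: eq_g; rewrite ltnS leq_max (leq_trans le_me le_e) orbT.
have -> : (g n).2 = ~~ `[< acc >].
  by rewrite eq_g ?ltnS ?leq_maxl // /upd eqxx.
have outE : out M (oplus SAT (oracle g)) (nseq n true) true <-> acc.
  split=> [[j [c' [r hlt]]]|[j [c' [le_jK r hlt]]]].
    have [le_jK _] := bounded _ _ _ r; rewrite size_nseq in le_jK.
    by exists j, c'; split=> //; apply/(agree _ agree_g).
  by exists j, c'; split=> //; apply/(agree _ agree_g).
rewrite outE; case: (asboolP acc) => [acc_x [/(_ acc_x)]|no_acc [_ h]] //.
exact/no_acc/h.
Qed.

(** * Enumeration of the machines and diagonalization *)

(** Finite extension method: stage [i] freezes an initial segment that forces requirement [i], and
    later stages keep it. *)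
Lemma finite_extension (T : Type) (f0 : nat -> T) (Req : nat -> (nat -> T) -> Prop) :
    (forall i f b, exists f' b', [/\ b < b', forall n, n < b -> f' n = f n &
       forall g, (forall n, n < b' -> g n = f' n) -> Req i g]) ->
  exists f, forall i, Req i f.
Proof.
move=> ext.
have /choice[next nextP] (a : nat * ((nat -> T) * nat)) :
    exists r : (nat -> T) * nat, [/\ a.2.2 < r.2,
      forall n, n < a.2.2 -> r.1 n = a.2.1 n &
      forall g, (forall n, n < r.2 -> g n = r.1 n) -> Req a.1 g].
  by have [f' [b' P]] := ext a.1 a.2.1 a.2.2; exists (f', b').
pose st := fix st i := if i is j.+1 then next (j, st j) else (f0, 0).
have le_st i : i <= (st i).2.
  elim: i => // i IHi; have [lt_b _ _] := nextP (i, st i).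
  exact: leq_ltn_trans IHi lt_b.
have st_stable i j n : n < (st i).2 -> (st (i + j)).1 n = (st i).1 n /\ n < (st (i + j)).2.
  move=> lt_n; elim: j => [|j [IH1 IH2]]; first by rewrite addn0.
  rewrite addnS /=; have [lt_b eq_f _] := nextP (i + j, st (i + j)).
  by rewrite eq_f // IH1; split=> //; apply: ltn_trans lt_b.
exists (fun n => (st n.+1).1 n) => i.
have [_ _] := nextP (i, st i); apply => n; rewrite -/(st i.+1) => lt_n.
have lt_n' : n < (st n.+1).2 by apply: le_st.
case: (leqP n i) => [le_ni|lt_in].
  have -> : i.+1 = n.+1 + (i - n) by lia.
  by have [->] := st_stable _ (i - n) _ lt_n'.
have -> : n.+1 = i.+1 + (n - i) by lia.
by have [->] := st_stable _ (n - i) _ lt_n.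
Qed.

(** * Renaming states and symbols *)

Section Transport.
Variables (O : Type) (M : machine O) (Q S : finType).
Variables (fq : state M -> Q) (fs : symbol M -> S).
Variables (bl : S) (bt : bool -> S) (st : Q).
Variables (pr : Q -> instruction O Q S (extra M).+1).
Variables (bi : injective bt) (bn : forall b, bt b != bl).

Let M' := Machine st pr bi bn.

Definition map_transition (m : transition (state M) (symbol M) (extra M).+1) :
    transition Q S (extra M).+1 :=
  (fq m.1.1, [ffun i => (fs (m.1.2 i).1, (m.1.2 i).2)], m.2).

Definition instruction_sim (I : instruction O (state M) (symbol M) (extra M).+1)
    (I' : instruction O Q S (extra M).+1) : Prop :=
  match I, I' with
  | Halt o, Halt o' => o = o'
  | Query q1 q2, Query q1' q2' => q1' = fq q1 /\ q2' = fq q2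
  | Step g, Step g' => forall (v : {ffun 'I_(extra M).+1 -> symbol M}) m',
      m' \in g' [ffun i => fs (v i)] <-> exists2 m, m \in g v & m' = map_transition m
  | _, _ => False
  end.

Hypotheses (blE : fs (blank M) = bl) (btE : forall b, fs (bit M b) = bt b).
Hypotheses (stE : fq (start M) = st).
Hypothesis (prE : forall q, instruction_sim (program q) (pr (fq q))).

Definition map_tape (t : tape M) : tape M' := (map fs t.1, map fs t.2).

Definition map_config (c : config M) : config M' :=
  @Config O M' (fq (cstate c)) [ffun i => map_tape (tapes c i)] (oracle_tape c).

Lemma map_init x : init M' x = map_config (init M x).
Proof.
congr Config; first exact: esym stE.
apply/ffunP=> i; rewrite !ffunE /map_tape /=; congr pair.
by case: ifP => // _; rewrite -map_comp; apply: eq_map => b /=; rewrite btE.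
Qed.

Lemma head_map_blank (s : seq (symbol M)) : head bl (map fs s) = fs (head (blank M) s).
Proof. by case: s => [|a s] /=; rewrite ?blE. Qed.

Lemma map_apply c m :
  @apply_transition O M' (map_config c) (map_transition m) =
  map_config (apply_transition c m).
Proof.
case: m => [[q acts] o]; rewrite /map_config /=; congr Config.
apply/ffunP=> i; rewrite !ffunE /map_tape /write_move /=.
by case: (acts i).2; rewrite /= ?head_map_blank -?behead_map.
Qed.

Lemma map_step D c c' :
  @step O M' D (map_config c) c' <-> exists2 c1, step D c c1 & c' = map_config c1.
Proof.
rewrite /step /=; have := prE (cstate c).
case: (program (cstate c)) => [o|q1 q2|g]; case: (pr _) => [o'|q1' q2'|g'] //=.
- by move=> _; split=> // -[].
- move=> [-> ->]; split=> [->|[_ -> ->]].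
    by eexists; first reflexivity; rewrite /map_config /=; case: ifP.
  by rewrite /map_config /=; case: ifP.
move=> gE; set v := [ffun i => scan (tapes c i)].
have -> : [ffun i => @scan O M' ([ffun i0 => map_tape (tapes c i0)] i)] =
    [ffun i => fs (v i)].
  by apply/ffunP=> i; rewrite !ffunE /scan /= head_map_blank.
split=> [[m' /gE[m gm ->] ->]|[c1 [m gm ->] ->]].
  by exists (apply_transition c m); [exists m | apply: map_apply].
by exists (map_transition m); [apply/gE; exists m | rewrite -map_apply].
Qed.

Lemma map_run D n c c' :
  @run O M' D n (map_config c) c' <-> exists2 c1, run D n c c1 & c' = map_config c1.
Proof.
elim: n c' => [|n IHn] c'.
  split=> [r|[c1 r ->]]; inversion r; subst; last exact: run0.
  by exists c => //; apply: run0.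
split=> [/run_last[c2 /IHn[c1 r1 ->] /map_step[c3 st1 ->]]|[c3 /run_last[c1 r1 st1] ->]].
  by exists c3 => //; apply: runS st1.
by apply/run_last; exists (map_config c1); [apply/IHn; exists c1 | apply/map_step; exists c3].
Qed.

Lemma map_halted c o : @halted O M' (map_config c) o <-> halted c o.
Proof.
rewrite /halted /=; have := prE (cstate c).
case: (program _) => [o1|q1 q2|g]; case: (pr _) => [o'|q1' q2'|g'] //=.
by move=> ->; split=> -[->].
Qed.

Lemma out_transport D x o : out M' D x o <-> out M D x o.
Proof.
rewrite /out /= map_init; split=> [[n [c [/map_run[c1 r1 ->] /map_halted h]]]|[n [c [r h]]]].
  by exists n, c1.
by exists n, (map_config c); split; [apply/map_run; exists c | apply/map_halted].
Qed.

Lemma time_bounded_transport p D : time_bounded M p D -> time_bounded M' p D.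
Proof.
move=> B x n c'; rewrite map_init => /map_run[c r ->].
have [le_np live] := B _ _ _ r; split=> //; case: live => [[c1 st1]|[o h]].
  by left; exists (map_config c1); apply/map_step; exists c1.
by right; exists o; apply/map_halted.
Qed.

(** [deterministic] quantifies over all states and symbols, reachable or not, so the renamings have
    to be onto; [gq] and [gs] are sections. *)
Lemma deterministic_transport (gq : Q -> state M) (gs : S -> symbol M) :
  cancel gq fq -> cancel gs fs -> deterministic M -> deterministic M'.
Proof.
move=> gqK gsK detM q g' pr_q v'; have := prE (gq q); rewrite gqK /= in pr_q *.
rewrite [pr q]pr_q; case E: (program (gq q)) => [//|//|g] /= gE.
have {gE} := gE [ffun i => gs (v' i)].
have -> : [ffun i => fs ([ffun i => gs (v' i)] i)] = v'.
  by apply/ffunP=> i; rewrite !ffunE gsK.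
move=> gE; apply/card_le1_eqP => m1 m2 /gE[n1 gn1 ->] /gE[n2 gn2 ->].
by have /card_le1_eqP/(_ _ _ gn1 gn2)-> := detM _ _ E [ffun i => gs (v' i)].
Qed.

End Transport.

(** Machines range over arbitrary finite types; with ordinals as states and symbols, the blank, the
    bits, the start and the program form finite data, hence countably many machines. *)
Definition table (a b k : nat) : finType :=
  ('I_b * {ffun bool -> 'I_b} * 'I_a * {ffun 'I_a -> bool + 'I_a * 'I_a +
     {ffun {ffun 'I_k.+1 -> 'I_b} -> {set transition 'I_a 'I_b k.+1}}})%type.

Definition valid_table a b k (d : table a b k) : bool :=
  injectiveb d.1.1.2 && [forall c, d.1.1.2 c != d.1.1.1].

Definition valid_tables a b k : countType := {d : table a b k | valid_table d}.

Lemma table_bit_inj a b k (u : valid_tables a b k) : injective (val u).1.1.2.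
Proof. by have /andP[/injectiveP] := valP u. Qed.

Lemma table_bit_neq a b k (u : valid_tables a b k) c :
  (val u).1.1.2 c != (val u).1.1.1.
Proof. by have /andP[_ /forallP] := valP u. Qed.

Definition table_program a b k (d : table a b k) (q : 'I_a) :
    instruction bool 'I_a 'I_b k.+1 :=
  match d.2 q with
  | inl (inl o) => Halt o
  | inl (inr (q1, q2)) => Query q1 q2
  | inr g => Step g
  end.

Definition table_machine a b k (u : valid_tables a b k) : machine bool :=
  Machine (val u).1.2 (table_program (val u)) (@table_bit_inj _ _ _ u)
    (table_bit_neq u).

(** A polynomial accompanies each machine because the block chosen against it depends on the time
    bound. The table has its own code [j] because its type depends on [a], [b] and [k]. *)
Definition decode (i : nat) : option (machine bool * {poly nat}) :=
  if (unpickle i : option (nat * nat * nat * nat * seq nat)) is Some (a, b, k, j, s) then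
    if unpickle j is Some u then Some (@table_machine a b k u, Poly (s : seq nat)) else None
  else None.

Lemma decode_complete (M : machine bool) (p : {poly nat}) : deterministic M ->
  exists i M', [/\ decode i = Some (M', p), deterministic M',
    forall D q, time_bounded M q D -> time_bounded M' q D &
    forall D x o, out M' D x o <-> out M D x o].
Proof.
move=> detM; pose fq : state M -> _ := enum_rank; pose fs : symbol M -> _ := enum_rank.
pose gq : 'I_#|state M| -> state M := enum_val.
pose gs : 'I_#|symbol M| -> symbol M := enum_val.
pose d : table #|state M| #|symbol M| (extra M) :=
  (fs (blank M), [ffun b => fs (bit M b)], fq (start M),
   [ffun q => match program (gq q) with
    | Halt o => inl (inl o)
    | Query q1 q2 => inl (inr (fq q1, fq q2))
    | Step g => inr [ffun v : {ffun _ -> _} =>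
        [set map_transition fq fs m | m in g [ffun i => gs (v i)]]]
    end]).
have fqK : cancel fq gq by exact: enum_rankK.
have fsK : cancel fs gs by exact: enum_rankK.
have fs_inj : injective fs by exact: can_inj fsK.
have vd : valid_table d.
  apply/andP; split.
    by apply/injectiveP => b1 b2; rewrite !ffunE => /fs_inj/bit_inj.
  by apply/forallP => b; rewrite ffunE (inj_eq fs_inj) bit_neq_blank.
pose u : valid_tables _ _ _ := Sub d vd.
have prE q : instruction_sim fq fs (program q) (table_program (val u) (fq q)).
  rewrite /table_program SubK ffunE fqK.
  case: (program q) => [o|q1 q2|g] //= v m'; rewrite ffunE.
  have -> : [ffun i => gs ([ffun i => fs (v i)] i)] = v.
    by apply/ffunP=> i; rewrite !ffunE fsK.
  by split=> [/imsetP|[m ? ->]]; last exact: imset_f.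
have bitE b : fs (bit M b) = (val u).1.1.2 b by rewrite /= ffunE.
exists (pickle (#|state M|, #|symbol M|, extra M, pickle u, polyseq p)), (table_machine u).
split=> [|||D x o].
- by rewrite /decode pickleK pickleK polyseqK.
- by apply: (deterministic_transport prE) detM; apply: enum_valK.
- by move=> D q; apply: time_bounded_transport => //.
- by apply: out_transport.
Qed.

(** * The language of [N] and the separation *)

Lemma N_behaves D x :
  behaves D (init N x) (11 * size x + 21)
    (fun o => exists2 w, size w = size x & verdict D w = o).
Proof.
have -> : 11 * size x + 21 = 10 * (size ([::] : word) + size x) + 20 + (size x).+1.
  by rewrite /=; lia.
rewrite (_ : init N x = cfg (Guess (all id [::])) (rev (map Some [::]), map Some x) [::]).
  exact: (guess_behaves D [::] x).
by congr Config; apply/ffunP=> i; rewrite !ffunE ord1.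
Qed.

Lemma out_N D x o : out N D x o <-> exists2 w, size w = size x & verdict D w = o.
Proof. by have [_] := N_behaves D x; apply. Qed.

Lemma N_NPTM : NPTM N.
Proof.
exists (Poly [:: 21; 11]) => D x n c r.
have [/(_ n c r)[le_n live] _] := N_behaves D x; split=> //.
rewrite horner_Poly; apply: leq_trans le_n _.
change (11 * size x + 21 <= (0 * size x + 11) * size x + 21); lia.
Qed.

Lemma N_robustly_overproductive : robustly_overproductive N.
Proof.
move=> D x outE.
have [w sz_w odd_w] := odd_vertex (fun e => false :: e \in D) (size x).
have : out N D x (verdict D w) by apply/out_N; exists w.
by rewrite outE /verdict /unbalanced odd_w; case: ifP => _ eqU; discriminate eqU.
Qed.

(** In [trail_degree] the term of the start [1^n] cancels against [all id w], which leaves only the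
    end of the walk. *)
Lemma unbalanced_oracle f w :
  unbalanced (oracle f) w = (w == front f (size w)).
Proof.
rewrite /unbalanced /front !(@oracle_edge _ _ (size w)) ?size_rcons //.
have -> : all id w = (w == nseq (size w) true).
  by rewrite -(sameP (all_pred1P true w) eqP); apply: eq_all => -[].
have := @trail_degree (nseq (size w) true) (f (size w)).1 w.
rewrite size_nseq => /(_ erefl).
by do 4!case: (traversed _ _ _); do 2!case: (w == _).
Qed.

Lemma out_N_oracle f x o : out N (oracle f) x o ->
  o = Unknown \/ o = if (f (size x)).2 then Acc else Rej.
Proof.
move=> /out_N[w sz_w <-]; rewrite /verdict unbalanced_oracle sz_w.
case: eqP => [eq_w|]; [right | by left].
by rewrite (@oracle_colour _ _ (size x)) // eq_w eqxx.
Qed.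

Lemma language_N_oracle f x : language N (oracle f) x <-> (f (size x)).2.
Proof.
split=> [/out_N_oracle[]|col] //; first by case: ifP.
apply/out_N; exists (front f (size x)); rewrite ?size_front //.
rewrite /verdict unbalanced_oracle size_front eqxx.
by rewrite (@oracle_colour _ _ (size x)) ?size_front ?eqxx ?col.
Qed.

Lemma diagonal_oracle : exists f, ~ P_rel (oplus SAT (oracle f)) (language N (oracle f)).
Proof.
pose Req i (g : nat -> block) := forall M p, decode i = Some (M, p) ->
  deterministic M -> time_bounded M p (oplus SAT (oracle g)) ->
  exists n, ~ (out M (oplus SAT (oracle g)) (nseq n true) true <-> (g n).2).
have [i f b|f reqf] := @finite_extension block (fun=> ([::], false)) Req.
  case: (pselect (exists M p, decode i = Some (M, p) /\ deterministic M)).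
    move=> [M [p [dec_i detM]]].
    have [f' [b' [lt_b eq_f reqM]]] := diagonal_block p f b detM.
    exists f', b'; split=> // g eq_g M' p'; rewrite dec_i => -[<- <-] _.
    exact: reqM.
  move=> no_M; exists f, b.+1; split=> // g _ M p dec_i detM.
  by case: no_M; exists M, p.
exists f => -[M [detM [p bounded] langE]].
have [i [M' [dec_i detM' bounded' outE]]] := decode_complete p detM.
have [n] := reqf _ _ _ dec_i detM' (bounded' _ _ bounded); apply.
have := language_N_oracle f (nseq n true); rewrite size_nseq langE => <-.
exact: outE.
Qed.

Theorem theorem4p6 :
  exists A E : set word, le_TO A E /\ ~ P_rel (oplus SAT E) A.
Proof.
have [f not_P] := diagonal_oracle.
exists (language N (oracle f)), (oracle f); split=> //.
exists N; split=> //; [exact: N_NPTM | exact: N_robustly_overproductive |].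
(* The colour of block [size x] dictates every outcome other than [Unknown]. *)
move=> x both; have /out_N_oracle[] := both Acc (or_introl erefl) => //.
have /out_N_oracle[] := both Rej (or_intror erefl) => //.
by case: ifP.
Qed.
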